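(* Let $\mathcal{P}$ be a finite-horizon POMDP with associated fully observed MDP $\mathcal{M} = \langle \mathcal{S}, \mathcal{A}, \{P_{S,t}\}_{t=1}^{T-1}, \{c_t\}_{t=1}^T, T\rangle$, and let $\{\mathcal{E}_t\}_{t=1}^T$, $\mathcal{E}_t \colon \mathcal{H}_t \to \mathcal{S}$, be state estimation functions (all as in the context). Assume: (i) $\mathcal{M}$ satisfies measurable selection; (ii) there are concave and non-decreasing functions $F^P_t, F^c_t \colon \mathbb{R}_{\ge 0} \to \mathbb{R}_{\ge 0}$ such that for all $s, s' \in \mathcal{S}$ and $a \in \mathcal{A}$, $$d_{\mathrm{Was}}(P_{S,t}(\cdot | s, a), P_{S,t}(\cdot | s', a)) \le F^P_t(d_{\mathcal{S}}(s, s')) \quad (t \in \{1,\dots,T-1\}),$$ $$| c_t(s,a) - c_t(s',a) | \le F^c_t(d_{\mathcal{S}}(s, s')) \quad (t \in \{1,\dots,T\});$$ (iii) for every $t \in \{1, \dots, T\}$, $\eta_t := \sup_{h_t \in \mathcal{H}_t} \mathbb{E}[ d_{\mathcal{S}}(S_t, \mathcal{E}_t(h_t)) \mid h_t ] < \infty$. Define $\varepsilon_t = F^c_t(\eta_t)$ for $t \in \{1,\dots,T\}$ and $\delta_t = F^P_t(\eta_t) + \eta_{t+1}$ for $t \in \{1,\dots,T-1\}$. Let $\pi^{\mathcal{M}}$ be an optimal policy of $\mathcal{M}$, let $\{V^{\mathcal{M}}_t\}_{t=1}^T$ be the optimal value functions of $\mathcal{M}$, and let $\mu^{\mathcal{E}}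 = (\mu^{\mathcal{E}}_1,\dots,\mu^{\mathcal{E}}_T)$ be the certainty equivalent policy $\mu^{\mathcal{E}}_t(h_t) = \pi^{\mathcal{M}}_t(\mathcal{E}_t(h_t))$. Then for every $t \in \{1,\dots,T\}$ and $h_t \in \mathcal{H}_t$, $$W^{\mathcal{P}, \mu^{\mathcal{E}}}_t(h_t) - W^{\mathcal{P}}_t(h_t) \le 2 \alpha_t, \qquad \text{where } \alpha_t = \varepsilon_t + \sum_{\tau = t}^{T-1}\bigl[ \delta_{\tau}\,\mathrm{Lip}(V^{\mathcal{M}}_{\tau+1}) + \varepsilon_{\tau+1} \bigr].$$
   Context: POMDP $\mathcal{P}$: horizon $T$; state, observation and action spaces $\mathcal{S}, \mathcal{Y}, \mathcal{A}$ are metric spaces that are Borel spaces; $d_{\mathcal{S}}$ is the metric on $\mathcal{S}$. The initial pair $(S_1, Y_1)$ has law $\xi \in \Delta(\mathcal{S} \times \mathcal{Y})$, where $\Delta(\mathcal X)$ denotes the probability measures on $\mathcal X$. For $t \in \{1,\dots,T-1\}$ there is a stochastic kernel $P_t \colon \mathcal{S} \times \mathcal{A} \to \Delta(\mathcal{S} \times \mathcal{Y})$ with $\mathbb{P}(S_{t+1} \in M_S, Y_{t+1} \in M_Y \mid s_{1:t}, y_{1:t}, a_{1:t}) = P_t(M_S, M_Y \mid s_t, a_t)$. $P_{S,t}(\cdot|s,a)$ is its marginal on $\mathcal{S}$. The per-step costs $c_t \colon \mathcal{S} \times \mathcal{A} \to \mathbb{R}$, $t\in\{1,\dots,T\}$,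 are measurable and uniformly bounded: $\sup_{s,a}|c_t(s,a)| \le c_{\max}$. All policies, estimators and functions are measurable. Histories and beliefs: $h_t = (y_{1:t}, a_{1:t-1}) \in \mathcal{H}_t$. $b_{t|t}(\cdot|h_t)$ is the posterior law of $S_t$ given $h_t$; it does not depend on the policy. Concretely, $b_{1|1}(\cdot|y_1)$ disintegrates $\xi$ with respect to $y_1$; $b_{t+1|t}(M_S, M_Y|h_t,a_t) = \int_{\mathcal{S}} P_t(M_S,M_Y|s,a_t)\, b_{t|t}(ds|h_t)$; and $b_{t+1|t+1}(\cdot|h_t,a_t,y_{t+1})$ disintegrates $b_{t+1|t}(\cdot,\cdot|h_t,a_t)$ with respect to $y_{t+1}$ (a version of these kernels is fixed). $\mathbb{E}[f(S_t)|h_t]$ denotes $\int f\,db_{t|t}(\cdot|h_t)$, and conditional expectations of future quantities given $h_t$ under a policy are computed by starting from $S_t \sim b_{t|t}(\cdot|h_t)$ and evolving forward with the kernels $P_\tau$ and the policy. Values in $\mathcal{P}$: for a deterministic history-dependent policy $\mu = (\mu_1,\dots,\mu_T)$, $\mu_t\colon \mathcal{H}_t \to \mathcal{A}$, $W^{\mathcal{P},\mu}_t(h_t) = \mathbb{E}^{\mu}[\sum_{\tau=t}^T c_\tau(S_\tau, A_\tau) \mid h_t]$, and $W^{\mathcal{P}}_t(h_t) = \inf_\mu W^{\mathcal{P},\mu}_t(h_t)$ over all history-dependent policies. Measurable selection: the MDP $\mathcal{M}$ satisfies measurable selection if for every measurable $V\colon \mathcal{S}\to\mathbb{R}$ (for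 which the integrals below are well defined) and each $t$ there is a measurable $\pi\colon \mathcal{S} \to \mathcal{A}$ such that for all $s$, $\inf_{a \in \mathcal{A}} \{ c_t(s,a) + \int V(s') P_{S,t}(ds'|s,a) \} = c_t(s,\pi(s)) + \int V(s') P_{S,t}(ds'|s,\pi(s)) =: V_+(s)$, and $V_+\colon \mathcal{S}\to\mathbb{R}$ is measurable (at $t=T$ the integral term is absent). Optimal value functions and policy of $\mathcal{M}$: $V^{\mathcal{M}}_{T+1} = 0$ and $V^{\mathcal{M}}_t(s) = \min_{a}\{c_t(s,a) + \int V^{\mathcal{M}}_{t+1}(s') P_{S,t}(ds'|s,a)\}$ for $t = T,\dots,1$ (no integral term at $t=T$); an optimal policy $\pi^{\mathcal{M}} = (\pi_1^{\mathcal M},\dots,\pi_T^{\mathcal M})$ consists of measurable maps $\pi^{\mathcal{M}}_t\colon \mathcal{S}\to\mathcal{A}$ attaining these minima at every $s$ and $t$. $d_{\mathrm{Was}}(\nu_1,\nu_2) = \inf \mathbb{E}[d_{\mathcal{S}}(S_1,S_2)]$ over all couplings of $\nu_1, \nu_2$. $\mathrm{Lip}(f)$ is the Lipschitz constant of $f$ (with respect to $d_{\mathcal{S}}$ on the domain). *)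

(* Defs.v *)
(* Finite-horizon POMDPs over Borel spaces, in MathComp-Analysis.
   Times are numbered from 0: index t stands for time t + 1, so that the
   horizon T gives the decision times t < T, and the transition kernels matter
   for t.+1 < T only. *)
From HB Require Import structures.
From mathcomp Require Import all_boot all_order all_algebra.
From mathcomp Require Import all_classical all_reals all_analysis.
From mathcomp Require Import measurable_realfun.

Set Implicit Arguments.
Unset Strict Implicit.
Unset Printing Implicit Defensive.

Import Order.TTheory GRing.Theory Num.Theory.
Import numFieldNormedType.Exports.

Local Open Scope classical_set_scope.
Local Open Scope ring_scope.
Local Open Scope ereal_scope.

Section borel_space.
Context {R : realType}.

Definition complete_metric (X : metricType R) :=
  forall F : set_system X, ProperFilter F -> cauchy F -> exists x : X, F --> x.

Definition separable_space (X : topologicalType) :=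
  exists2 D : set X, countable D & dense D.

(* f is a homeomorphism onto its image, with the subspace topology. *)
Definition embedding (T X : topologicalType) (f : T -> X) :=
  injective f /\
  forall U : set T, open U <-> exists2 V : set X, open V & U = f @^-1` V.

(* S is homeomorphic to a Borel subset of a complete separable metric space. *)
Definition is_borel_space (S : topologicalType) :=
  exists (X : metricType R) (f : S -> X),
    [/\ complete_metric X, separable_space X, embedding f &
        <<s (@open X) >> (range f)].

End borel_space.

HB.mixin Record Metric_isBorelSpace (d : measure_display) (R : realType) T
    & Metric R T & Measurable d T := {
  borel_measurableE : @measurable d T = <<s (@open T) >> ;
  borel_spaceP : @is_borel_space R T }.

(* Metric spaces that are Borel spaces, with their Borel sigma-algebra. *)
#[short(type="borelSpaceType")]
HB.structure Definition BorelSpace (d : measure_display) (R : realType) :=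
  {T of Metric R T & Measurable d T & Metric_isBorelSpace d R T}.

Section metric_notions.
Context {d : measure_display} {R : realType} {S : borelSpaceType d R}.

Definition coupling (nu1 nu2 : set S -> \bar R) : set (probability (S * S)%type R) :=
  [set g | forall A : set S, measurable A ->
    g (A `*` setT) = nu1 A /\ g (setT `*` A) = nu2 A].

Definition dWas (nu1 nu2 : set S -> \bar R) : \bar R :=
  ereal_inf [set \int[g]_p (mdist p.1 p.2)%:E
            | g in [set g : probability (S * S)%type R | coupling nu1 nu2 g]].

(* The value is +oo when f is not Lipschitz; in products, 0 * +oo = 0. *)
Definition Lip (f : S -> \bar R) : \bar R :=
  ereal_inf [set L%:E | L in [set L : R | (0 <= L)%R /\
    forall s s' : S, `|f s - f s'| <= (L * mdist s s')%:E]].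

End metric_notions.

Section fst_kernel.
Context d d1 d2 (X : measurableType d) (Y : measurableType d1)
  (Z : measurableType d2) (R : realType) (k : R.-pker X ~> (Y * Z)%type).

Definition fst_kernel (x : X) : set Y -> \bar R := pushforward (k x) fst.

Let fst_preimage (U : set Y) : fst @^-1` U = U `*` [set: Z].
Proof. by apply/seteqP; split => [[y z]|[y z] []]. Qed.

Let fst_kernel0 x : fst_kernel x set0 = 0.
Proof. by rewrite /fst_kernel /pushforward preimage_set0 measure0. Qed.

Let fst_kernel_ge0 x U : 0 <= fst_kernel x U.
Proof. exact: measure_ge0. Qed.

Let fst_kernel_sigma_additive x : semi_sigma_additive (fst_kernel x).
Proof.
move=> F mF tF mUF; rewrite /fst_kernel /pushforward preimage_bigcup.
apply: measure_semi_sigma_additive.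
- by move=> n; rewrite fst_preimage; exact: measurableX.
- apply/trivIsetP => /= i j _ _ ij; rewrite -preimage_setI.
  by move/trivIsetP : tF => /(_ _ _ _ _ ij) ->//; rewrite preimage_set0.
- by rewrite -preimage_bigcup fst_preimage; exact: measurableX.
Qed.

HB.instance Definition _ x := isMeasure.Build _ _ _ (fst_kernel x)
  (fst_kernel0 x) (fst_kernel_ge0 x) (@fst_kernel_sigma_additive x).

Definition mfst_kernel : X -> {measure set Y -> \bar R} := fst_kernel.

Let measurable_fst_kernel U :
  measurable U -> measurable_fun [set: X] (mfst_kernel ^~ U).
Proof.
move=> mU; rewrite /mfst_kernel /= /fst_kernel /pushforward fst_preimage.
by apply: (measurable_kernel k); exact: measurableX.
Qed.

HB.instance Definition _ := isKernel.Build _ _ _ _ _ mfst_kernel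
  measurable_fst_kernel.

Let fst_kernel_setT x : mfst_kernel x [set: Y] = 1.
Proof. exact: prob_kernel. Qed.

HB.instance Definition _ := Kernel_isProbability.Build _ _ _ _ _ mfst_kernel
  fst_kernel_setT.

End fst_kernel.

Section mdp.
Context {dS dA : measure_display} {R : realType}.

Record mdp (S : borelSpaceType dS R) (A : borelSpaceType dA R) := MDP {
  mdp_horizon : nat ;
  mdp_trans : nat -> R.-pker (S * A) ~> S ;
  mdp_cost : nat -> (S * A)%type -> R }.

Context {S : borelSpaceType dS R} {A : borelSpaceType dA R} (M : mdp S A).
Local Notation T := (mdp_horizon M).

Definition mdp_Q (t : nat) (V : S -> \bar R) (s : S) (a : A) : \bar R :=
  (mdp_cost M t (s, a))%:E +
  (if (t.+1 < T)%N then \int[mdp_trans M t (s, a)]_s' V s' else 0).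

Definition measurable_selection :=
  forall (V : S -> R) (t : nat), (t < T)%N ->
    measurable_fun [set: S] V ->
    ((t.+1 < T)%N ->
      forall sa, (mdp_trans M t sa).-integrable [set: S] (EFin \o V)) ->
    exists (pi : S -> A) (Vplus : S -> R),
      [/\ measurable_fun [set: S] pi, measurable_fun [set: S] Vplus &
          forall s, ereal_inf (range (mdp_Q t (EFin \o V) s)) = (Vplus s)%:E /\
                    mdp_Q t (EFin \o V) s (pi s) = (Vplus s)%:E].

(* Optimal value at time t of the problem stopped after n more stages. *)
Fixpoint mdp_value_to_go (n t : nat) : S -> \bar R :=
  if n is n'.+1 then
    fun s => ereal_inf (range (mdp_Q t (mdp_value_to_go n' t.+1) s))
  else fun=> 0.

Definition mdp_value (t : nat) : S -> \bar R := mdp_value_to_go (T - t) t.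

Definition mdp_optimal_policy (pi : nat -> S -> A) :=
  forall t, (t < T)%N -> measurable_fun [set: S] (pi t) /\
    forall s, mdp_Q t (mdp_value t.+1) s (pi t s) = mdp_value t s.

End mdp.

Section pomdp.
Context {dS dY dA : measure_display} {R : realType}.

Record pomdp (S : borelSpaceType dS R) (Y : borelSpaceType dY R)
    (A : borelSpaceType dA R) := POMDP {
  horizon : nat ;
  init : probability (S * Y)%type R ;
  trans : nat -> R.-pker (S * A) ~> (S * Y)%type ;
  cost : nat -> (S * A)%type -> R ;
  cmax : R ;
  measurable_cost : forall t, (t < horizon)%N ->
    measurable_fun [set: S * A] (cost t) ;
  cost_bounded : forall t, (t < horizon)%N ->
    forall sa, (`|cost t sa| <= cmax)%R }.

Context {S : borelSpaceType dS R} {Y : borelSpaceType dY R}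
  {A : borelSpaceType dA R} (P : pomdp S Y A).
Local Notation T := (horizon P).

Definition pomdp_mdp : mdp S A :=
  MDP T (fun t => mfst_kernel (trans P t)) (cost P).

Fixpoint hist_display (t : nat) : measure_display :=
  if t is t'.+1 then
    measure_prod_display (measure_prod_display (hist_display t', dA), dY)
  else dY.

(* A history at t.+1 is ((h, a), y), with h a history at t. *)
Fixpoint hist (t : nat) : measurableType (hist_display t) :=
  match t with
  | 0 => Y
  | t'.+1 => (hist t' * A * Y)%type
  end.

Section belief.
Variable b : forall t, R.-pker (hist t) ~> S.

(* One-step prediction, the law of (S_{t+1}, Y_{t+1}) given (h_t, a_t). *)
Definition predict (t : nat) (h : hist t) (a : A) (U : set (S * Y)) : \bar R :=
  \int[b t h]_s trans P t (s, a) U.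

(* The kernels b are versions of the posterior laws of the state. *)
Definition is_belief :=
  (forall (MS : set S) (MY : set Y), measurable MS -> measurable MY ->
    init P (MS `*` MY) =
      \int[pushforward (init P) snd]_(y in MY) b 0%N y MS) /\
  (forall t, (t.+1 < T)%N -> forall (h : hist t) (a : A)
      (MS : set S) (MY : set Y), measurable MS -> measurable MY ->
    predict h a (MS `*` MY) =
      \int[pushforward (predict h a) snd]_(y in MY)
        b t.+1 ((h, a), y) MS).

Definition policy := forall t, hist t -> A.

Definition measurable_policy (mu : policy) :=
  forall t, (t < T)%N -> measurable_fun [set: hist t] (mu t).

Section evaluation.
Variables (mu : policy) (t : nat) (h : hist t).

(* run k is the space of the outcomes (S_t, (S_{t+1}, Y_{t+1}), ...,
   (S_{t+k}, Y_{t+k})) that follow the history h at time t. *)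
Fixpoint run (k : nat) : Type :=
  if k is k'.+1 then (run k' * (S * Y))%type else S.

Definition run_state (k : nat) : run k -> S :=
  match k with
  | 0 => fun w => w
  | k'.+1 => fun w => w.2.1
  end.

Fixpoint run_hist (k : nat) : run k -> hist (k + t) :=
  match k with
  | 0 => fun=> h
  | k'.+1 => fun w =>
      ((run_hist w.1, mu (run_hist w.1)), w.2.2)
  end.

Definition run_action (k : nat) (w : run k) : A := mu (run_hist w).

Fixpoint run_cost (k : nat) : run k -> R :=
  match k with
  | 0 => fun w => cost P t (run_state w, run_action w)
  | k'.+1 => fun w =>
      (run_cost w.1 + cost P (k'.+1 + t) (run_state w, run_action w))%R
  end.

(* Conditional expectation of f given h under mu: the iterated integral of f
   along S_t ~ b t h and (S_{t+i+1}, Y_{t+i+1}) ~ trans (S_{t+i}, A_{t+i}). *)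
Fixpoint run_expectation (k : nat) : (run k -> \bar R) -> \bar R :=
  match k with
  | 0 => fun f => \int[b t h]_s f s
  | k'.+1 => fun f => run_expectation (fun w : run k' =>
      \int[trans P (k' + t) (run_state w, run_action w)]_sy f (w, sy))
  end.

(* Meant for t < T: the run ends at the last decision time T.-1. *)
Definition policy_value : \bar R :=
  run_expectation (fun w : run (T.-1 - t) => (run_cost w)%:E).

End evaluation.

Definition pomdp_value (t : nat) (h : hist t) : \bar R :=
  ereal_inf [set policy_value mu h | mu in measurable_policy].

Definition estimation_error (E : forall t, hist t -> S) (t : nat) : \bar R :=
  ereal_sup (range (fun h : hist t => \int[b t h]_s (mdist s (E t h))%:E)).

End belief.

End pomdp.

Arguments hist {dY dA R} Y A t.
Arguments policy {dY dA R} Y A.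

(* F is regarded as a function on the nonnegative reals. *)
Definition modulus (R : realType) (F : R -> R) :=
  [/\ forall x, (0 <= x)%R -> (0 <= F x)%R,
      {in [pred x | (0 <= x)%R] &, {homo F : x y / (x <= y)%R}} &
      convex_function [set x : R^o | (0 <= x)%R] (fun x => (- F x)%R)].

(* Main.v *)
Require Import Defs.
From HB Require Import structures.
From mathcomp Require Import all_boot all_order all_algebra.
From mathcomp Require Import all_classical all_reals all_analysis.
From mathcomp Require Import measurable_realfun.
From mathcomp Require Import ring lra zify.

(* Let W be the cost-to-go of a policy and v the optimal value of the MDP. By
   backward induction, W_t(h) <= v_t(E h) + alpha_t for the certainty equivalent
   policy and W_t(h) >= v_t(E h) - alpha_t for every policy; the bound 2 alpha_t
   follows by subtraction. One Bellman step costs three errors: replacing S_t by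
   E h in the cost (Jensen for the concave Fc, giving eps_t), replacing S_t by
   E h in the transition (Kantorovich duality and Jensen for FP, giving
   Lip(v_(t+1)) FP(eta_t)), and replacing S_(t+1) by its estimate (giving
   Lip(v_(t+1)) eta_(t+1)). The belief kernels enter through the disintegration
   of the one-step prediction. *)

Set Implicit Arguments.
Unset Strict Implicit.
Unset Printing Implicit Defensive.

Import Order.TTheory GRing.Theory Num.Theory.
Import numFieldNormedType.Exports.

Local Open Scope classical_set_scope.
Local Open Scope ring_scope.

(** * Bounded measurable functions and probability kernels *)

Section bounded_measurable.
Context {d : measure_display} {T : measurableType d} {R : realType}.

(** Such functions are integrable against every probability measure and stable under the operations
    below, so the argument can use real-valued integrals. *)
Definition bmeas (f : T -> R) :=
  measurable_fun [set: T] f /\ exists C : R, forall x, `|f x| <= C.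

Lemma bmeas_cst c : bmeas (fun=> c).
Proof. by split => //; exists `|c|. Qed.

Lemma bmeasD f g : bmeas f -> bmeas g -> bmeas (fun x => f x + g x).
Proof.
move=> [mf [C Cf]] [mg [D Dg]]; split; first exact: measurable_funD.
by exists (C + D) => x; rewrite (le_trans (ler_normD _ _))// lerD.
Qed.

Lemma bmeasZ c f : bmeas f -> bmeas (fun x => c * f x).
Proof.
move=> [mf [C Cf]]; split; first exact: measurable_funM.
by exists (`|c| * C) => x; rewrite normrM ler_wpM2l.
Qed.

Lemma bmeasN f : bmeas f -> bmeas (fun x => - f x).
Proof.
move=> [mf [C Cf]]; split; first exact: measurableT_comp.
by exists C => x; rewrite normrN.
Qed.

Lemma bmeasB f g : bmeas f -> bmeas g -> bmeas (fun x => f x - g x).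
Proof. by move=> bf bg; apply: bmeasD => //; exact: bmeasN. Qed.

Variables (m : {measure set T -> \bar R}) (m1 : m [set: T] = 1%E).

Lemma bmeas_integrable f : bmeas f -> m.-integrable [set: T] (EFin \o f).
Proof.
move=> [mf [C Cf]]; apply: measurable_bounded_integrable => //.
  by rewrite m1 ltry.
exists C; split => [|M CM x _]; first exact: num_real.
exact: le_trans (Cf x) (ltW CM).
Qed.

Lemma bmeas_RintegralE f : bmeas f ->
  (\int[m]_x f x)%:E = (\int[m]_x (f x)%:E)%E.
Proof.
move=> bf; rewrite fineK//; apply: integrable_fin_num => //.
exact: bmeas_integrable.
Qed.

Lemma bmeas_Rint_cst c : \int[m]_x c = c.
Proof. by rewrite Rintegral_cst//= m1 mulr1. Qed.

Lemma bmeas_RintD f g : bmeas f -> bmeas g ->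
  \int[m]_x (f x + g x) = \int[m]_x f x + \int[m]_x g x.
Proof. by move=> bf bg; rewrite RintegralD//; exact: bmeas_integrable. Qed.

Lemma bmeas_RintB f g : bmeas f -> bmeas g ->
  \int[m]_x (f x - g x) = \int[m]_x f x - \int[m]_x g x.
Proof. by move=> bf bg; rewrite RintegralB//; exact: bmeas_integrable. Qed.

Lemma bmeas_RintZ c f : bmeas f -> \int[m]_x (c * f x) = c * \int[m]_x f x.
Proof. by move=> bf; rewrite RintegralZl//; exact: bmeas_integrable. Qed.

Lemma bmeas_le_Rint f g : bmeas f -> bmeas g -> (forall x, f x <= g x) ->
  \int[m]_x f x <= \int[m]_x g x.
Proof. by move=> bf bg fg; apply: le_Rintegral => //; exact: bmeas_integrable. Qed.

Lemma bmeas_Rint_le f c : bmeas f -> (forall x, f x <= c) -> \int[m]_x f x <= c.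
Proof.
move=> bf fc; rewrite -[leRHS]bmeas_Rint_cst.
by apply: bmeas_le_Rint => //; exact: bmeas_cst.
Qed.

Lemma bmeas_norm_Rint f g : bmeas f -> bmeas g -> (forall x, `|f x| <= g x) ->
  `|\int[m]_x f x| <= \int[m]_x g x.
Proof.
move=> bf bg fg; rewrite ler_norml; apply/andP; split.
  rewrite lerNl -[leLHS]mulN1r -bmeas_RintZ//; apply: bmeas_le_Rint => //.
    exact: bmeasZ.
  by move=> x; rewrite mulN1r (le_trans _ (fg x))// -normrN ler_norm.
by apply: bmeas_le_Rint => // x; rewrite (le_trans _ (fg x))// ler_norm.
Qed.

Lemma bmeas_norm_Rint_le f c : bmeas f -> (forall x, `|f x| <= c) ->
  `|\int[m]_x f x| <= c.
Proof.
move=> bf fc; rewrite -[leRHS]bmeas_Rint_cst.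
by apply: bmeas_norm_Rint => //; exact: bmeas_cst.
Qed.

End bounded_measurable.

Lemma bmeas_comp {d d'} {T : measurableType d} {U : measurableType d'}
    {R : realType} (f : U -> R) (g : T -> U) :
  bmeas f -> measurable_fun [set: T] g -> bmeas (fun x => f (g x)).
Proof.
by move=> [mf [C Cf]] mg; split; [exact: measurableT_comp|exists C].
Qed.

(** The measure [n] is only assumed to agree with the image of [m] on measurable sets, so this
    change of variables covers marginals of couplings as well as of kernels. *)
Lemma Rintegral_image {d d'} {T : measurableType d} {U : measurableType d'}
    {R : realType} (m : {measure set T -> \bar R}) (n : {measure set U -> \bar R})
    (phi : T -> U) (f : U -> R) :
  m [set: T] = 1%E -> measurable_fun [set: T] phi -> bmeas f ->
  (forall B, measurable B -> n B = m (phi @^-1` B)) ->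
  \int[n]_x f x = \int[m]_x f (phi x).
Proof.
move=> m1 mphi bf nE; transitivity (fine (\int[pushforward m phi]_x (f x)%:E)%E).
  by congr fine; apply: eq_measure_integral => B mB _; exact: nE.
rewrite integral_pushforward//; first exact/measurable_EFinP/bf.1.
exact/bmeas_integrable/bmeas_comp.
Qed.

Section kernel_pullback.
Context d1 d2 d3 (X : measurableType d1) (Y : measurableType d2)
  (Z : measurableType d3) (R : realType).
Variables (f : X -> Y) (mf : measurable_fun [set: X] f) (k : R.-pker Y ~> Z).

(* The measurability proof is an argument so that the kernel instances below can
   be found by unification. *)
Definition kpull of measurable_fun [set: X] f : X -> {measure set Z -> \bar R} :=
  fun x => k (f x).

Let measurable_kpull U : measurable U ->
  measurable_fun [set: X] (kpull mf ^~ U).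
Proof.
by move=> mU; apply: (measurableT_comp (measurable_kernel k U mU)).
Qed.

HB.instance Definition _ := isKernel.Build _ _ _ _ _ (kpull mf) measurable_kpull.

Let kpull_setT x : kpull mf x [set: Z] = 1%E.
Proof. exact: prob_kernel. Qed.

HB.instance Definition _ := Kernel_isProbability.Build _ _ _ _ _ (kpull mf)
  kpull_setT.

End kernel_pullback.

Lemma bmeas_kernel d1 d2 (X : measurableType d1) (Y : measurableType d2)
    (R : realType) (k : R.-pker X ~> Y) (f : X * Y -> R) : bmeas f ->
  bmeas (fun x => \int[k x]_y f (x, y)).
Proof.
move=> bf; have [mf [C Cf]] := bf.
have bfx x : bmeas (fun y => f (x, y)) by exact: bmeas_comp.
split; last first.
  by exists C => x; apply: bmeas_norm_Rint_le => //; exact: prob_kernel.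
(* Adding the bound [C] makes the integrand nonnegative, as the measurability of kernel integrals
   requires; total mass 1 lets the constant be subtracted afterwards. *)
have -> : (fun x => \int[k x]_y f (x, y)) =
    (fun x => fine (\int[k x]_y (f (x, y) + C)%:E)%E - C).
  apply/funext => x; rewrite -[fine _]/(\int[k x]_y (f (x, y) + C)).
  rewrite bmeas_RintD ?prob_kernel//; last exact: bmeas_cst.
  by rewrite bmeas_Rint_cst ?prob_kernel// addrK.
apply: measurable_funB => //; apply: measurableT_comp => //.
apply: (measurable_fun_integral_finite_kernel (fun z => (f z + C)%:E)) => [z|].
  by rewrite lee_fin -lerBlDr sub0r; have := Cf z; rewrite ler_norml => /andP[].
by apply/measurable_EFinP; exact: measurable_funD.
Qed.

(** The nonnegative case applies to [f + C], and [C] contributes the same to both sides because all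
    kernels have mass 1. *)
Lemma bmeas_Rintegral_kcomp d1 d2 d3 (X : measurableType d1)
    (Y : measurableType d2) (Z : measurableType d3) (R : realType)
    (l : R.-pker X ~> Y) (k : R.-pker (X * Y) ~> Z) (f : Z -> R) x : bmeas f ->
  \int[kcomp l k x]_z f z = \int[l x]_y (\int[k (x, y)]_z f z).
Proof.
move=> bf; have [mf [C Cf]] := bf.
have m1 : kcomp l k x [set: Z] = 1%E.
  rewrite /kcomp; under eq_integral do rewrite prob_kernel.
  by rewrite integral_cst// mul1e prob_kernel.
have bk (g : Z -> R) : bmeas g -> bmeas (fun y => \int[k (x, y)]_z g z).
  move=> bg; have bg2 : bmeas (fun p : Y * Z => g p.2) by exact: bmeas_comp.
  exact: (bmeas_kernel (kpull k (pair1_measurable x)) bg2).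
have bC : bmeas (fun _ : Z => C) by exact: bmeas_cst.
have f0 z : 0 <= f z + C.
  by rewrite -lerBlDr sub0r; have := Cf z; rewrite ler_norml => /andP[].
have : \int[kcomp l k x]_z (f z + C) = \int[l x]_y (\int[k (x, y)]_z (f z + C)).
  have bfC : bmeas (fun z => f z + C) by exact: bmeasD.
  apply: EFin_inj; rewrite (bmeas_RintegralE m1 bfC).
  rewrite (bmeas_RintegralE (prob_kernel x) (bk _ bfC)).
  rewrite integral_kcomp => [|z|]; last 2 first.
  - by rewrite lee_fin.
  - by apply/measurable_EFinP; exact: measurable_funD.
  apply: eq_integral => y _.
  by rewrite (bmeas_RintegralE (prob_kernel (x, y)) bfC).
rewrite bmeas_RintD// bmeas_Rint_cst//.
under [X in _ = X -> _]eq_Rintegral.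
  move=> y _; rewrite bmeas_RintD ?prob_kernel// bmeas_Rint_cst ?prob_kernel//.
  over.
rewrite bmeas_RintD ?prob_kernel//; last 2 first.
- exact: bk.
- exact: bmeas_cst.
by rewrite bmeas_Rint_cst ?prob_kernel// => /addIr.
Qed.

(** * Disintegration of the one-step prediction *)

Section kernel_composition.
Context d1 d2 d3 (X : measurableType d1) (Y : measurableType d2)
  (Z : measurableType d3) (R : realType).
Variables (l : R.-pker X ~> Y) (k : R.-pker (X * Y) ~> Z).

Definition kpcomp : X -> {measure set Z -> \bar R} := mkcomp l k.

Let measurable_kpcomp U : measurable U -> measurable_fun [set: X] (kpcomp ^~ U).
Proof. exact: measurable_kernel. Qed.

HB.instance Definition _ := isKernel.Build _ _ _ _ _ kpcomp measurable_kpcomp.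

Let kpcomp_setT x : kpcomp x [set: Z] = 1%E.
Proof.
transitivity (\int[l x]_y cst 1 y)%E; last by rewrite integral_cst// mul1e prob_kernel.
by apply: eq_integral => y _; rewrite prob_kernel.
Qed.

HB.instance Definition _ := Kernel_isProbability.Build _ _ _ _ _ kpcomp kpcomp_setT.

Lemma bmeas_Rintegral_kpcomp (f : Z -> R) x : bmeas f ->
  \int[kpcomp x]_z f z = \int[l x]_y (\int[k (x, y)]_z f z).
Proof. exact: bmeas_Rintegral_kcomp. Qed.

End kernel_composition.

Section disintegration.
Context {dS dY dA : measure_display} {R : realType} {S : borelSpaceType dS R}
  {Y : borelSpaceType dY R} {A : borelSpaceType dA R} (P : pomdp S Y A)
  (b : forall t, R.-pker (hist Y A t) ~> S) (hb : is_belief P b) (t : nat).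
Local Notation H := (hist Y A t).

Let mtrans_arg : measurable_fun [set: (H * A) * S]
  (fun p : (H * A) * S => (p.2, p.1.2)).
Proof.
apply: measurable_fun_pair => //.
by apply: (@measurableT_comp _ _ _ _ _ _ snd) => //.
Qed.

(** The measure [predict h a] as a probability kernel in [(h, a)]; the two agree by unfolding. *)
Definition prediction :=
  kpcomp (kpull (b t) (@measurable_fst _ _ H A)) (kpull (trans P t) mtrans_arg).

Let mresample_hist : measurable_fun [set: (H * A) * (S * Y)]
  (fun p : (H * A) * (S * Y) => ((p.1, p.2.2) : hist Y A t.+1)).
Proof.
apply: measurable_fun_pair => //.
by apply: (@measurableT_comp _ _ _ _ _ _ snd) => //.
Qed.

Let mresample_pair : measurable_fun [set: ((H * A) * (S * Y)) * S]
  (fun q : ((H * A) * (S * Y)) * S => (q.2, q.1.2.2)).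
Proof.
apply: measurable_fun_pair => //.
apply: (@measurableT_comp _ _ _ _ _ _ snd) => //.
by apply: (@measurableT_comp _ _ _ _ _ _ snd) => //.
Qed.

(* Keeps the observation of a predicted pair and draws the state afresh from the
   updated belief; disintegration says that this preserves the prediction. *)
Definition resample :=
  kpcomp (kpull (b t.+1) mresample_hist) (kdirac mresample_pair).

(** Measurable rectangles generate the product and are stable under intersection; on them the claim
    is the equation in [is_belief]. *)
Let resample_prediction (tT : (t.+1 < horizon P)%N) h a (U : set (S * Y)) :
  measurable U -> prediction (h, a) U = kpcomp prediction resample (h, a) U.
Proof.
move=> mU.
pose G := [set U `*` V | U in @measurable _ S & V in @measurable _ Y].
apply: (measure_unique G (fun=> setT)) => //.
- exact: measurable_prod_measurableType.
- move=> _ _ [A1 mA1 [A2 mA2 <-]] [B1 mB1 [B2 mB2 <-]].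
  exists (A1 `&` B1); first exact: measurableI.
  by exists (A2 `&` B2); [exact: measurableI|rewrite setXI].
- by move=> _; exists setT => //; exists setT => //; rewrite setXTT.
- by rewrite bigcup_const.
- move=> _ [MS mMS [MY mMY <-]].
  have [_ /(_ _ tT h a MS MY mMS mMY)] := hb.
  rewrite -[predict _ _ _ _ _]/(prediction (h, a) (MS `*` MY)) => ->.
  rewrite -[predict _ _ _ _]/(prediction (h, a) : set _ -> _).
  have mb : measurable_fun [set: Y] (fun y => b t.+1 ((h, a), y) MS).
    exact: (measurableT_comp (measurable_kernel (b t.+1) MS mMS)).
  rewrite ge0_integral_pushforward//; last exact: measurable_funTS.
  rewrite integral_mkcond; apply: eq_integral => z _.
  rewrite patchE/=.
  (* The product of indicators links the restriction to [MY] with the mass that [resample] gives to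
     the rectangle. *)
  transitivity (\int[b t.+1 ((h, a), z.2)]_s (\1_MS s * \1_MY z.2)%:E)%E.
    have [zMY|zMY] := boolP (z.2 \in MY).
      rewrite mem_set//; last by rewrite -inE.
      rewrite indicE zMY; under eq_integral do rewrite mulr1.
      by rewrite integral_indic// setIT.
    rewrite memNset//=; last by move/mem_set; apply/negP.
    rewrite indicE (negbTE zMY); under eq_integral do rewrite mulr0.
    by rewrite integral0.
  apply: eq_integral => s _ /=.
  rewrite /kdirac diracE !indicE -natrM mulnb; congr (_%:R%:E).
  by rewrite in_setX.
- by move=> _; rewrite prob_kernel ltry.
Qed.

(** Integrates [f] against the two equal measures of [resample_prediction] and evaluates the Dirac
    part. In the induction this exchanges the true next state for the updated belief. *)
Lemma prediction_disintegration (tT : (t.+1 < horizon P)%N) h a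
    (f : S * Y -> R) : bmeas f ->
  \int[b t h]_s (\int[trans P t (s, a)]_z f z) =
  \int[prediction (h, a)]_z (\int[b t.+1 ((h, a), z.2)]_s f (s, z.2)).
Proof.
move=> bf.
transitivity (\int[prediction (h, a)]_z f z).
  by rewrite bmeas_Rintegral_kpcomp.
transitivity (\int[kpcomp prediction resample (h, a)]_z f z).
  congr fine; apply: eq_measure_integral => U mU _.
  exact: resample_prediction.
rewrite bmeas_Rintegral_kpcomp//; apply: eq_Rintegral => z _.
rewrite bmeas_Rintegral_kpcomp//; apply: eq_Rintegral => s _.
rewrite /Rintegral integral_dirac//; first by rewrite diracT mul1e.
by apply/measurable_EFinP; exact: bf.1.
Qed.

End disintegration.

(** * Lipschitz functions and the Wasserstein distance *)

Definition lipschitz_with (R : realType) (S : metricType R) (L : R) (f : S -> R) :=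
  forall s s', `|f s - f s'| <= L * mdist s s'.

Section infdist.
Context {R : realType} {S : metricType R}.
Variables (A : set S) (a0 : S) (Aa0 : A a0).

(** A genuine distance only for nonempty [A], since the real [inf] of the empty set is a default
    value; hence the witness [a0]. *)
Definition infdist (x : S) : R := inf [set mdist x a | a in A].

Lemma infdist_le x a : A a -> infdist x <= mdist x a.
Proof.
move=> Aa; apply: ge_inf; last by exists a.
by exists 0 => _ [c _ <-]; exact: mdist_ge0.
Qed.

Lemma le_infdist x r : (forall a, A a -> r <= mdist x a) -> r <= infdist x.
Proof.
move=> rA; apply: lb_le_inf; first by exists (mdist x a0); exists a0.
by move=> _ [a Aa <-]; exact: rA.
Qed.

Lemma infdist_lipschitz : lipschitz_with 1 infdist.
Proof.
have tri x y : infdist x - mdist x y <= infdist y.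
  apply: le_infdist => a Aa; rewrite lerBlDl.
  by rewrite (le_trans (infdist_le x Aa))// metric_triangle.
move=> x y; rewrite mul1r; have := tri x y; have := tri y x.
by rewrite metric_sym ler_norml => *; apply/andP; split; lra.
Qed.

End infdist.

(* Spares proving that the distance is jointly measurable on [S * S]. *)
Lemma ge0_le_integral_nonmeasurable d (T : measurableType d) (R : realType)
    (m : {measure set T -> \bar R}) (f g : T -> \bar R) :
  (forall x, 0 <= f x)%E -> (forall x, f x <= g x)%E ->
  (\int[m]_x f x <= \int[m]_x g x)%E.
Proof.
move=> f0 fg; have g0 x : (0 <= g x)%E := le_trans (f0 x) (fg x).
rewrite !ge0_integralTE//; apply: ereal_sup_le => _ [h hf <-].
by exists h => // x; exact: le_trans (hf x) (fg x).
Qed.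

Section borel.
Context {d : measure_display} {R : realType} {S : borelSpaceType d R}.

Lemma open_borel_measurable (U : set S) : open U -> measurable U.
Proof. by rewrite borel_measurableE => oU; exact: sub_sigma_algebra. Qed.

Lemma lipschitz_measurable L (f : S -> R) : lipschitz_with L f ->
  measurable_fun [set: S] f.
Proof.
move=> Lf; apply: (measurability _ (RGenOInfty.measurableE R)) => //.
move=> _ [_ [x ->] <-]; rewrite setTI; apply: open_borel_measurable.
rewrite openE => s /=; rewrite in_itv/= andbT => xs.
(* The sign of [L] is arbitrary, so [|L| + 1] serves as a positive divisor for the radius of a ball
   on which [f] stays above [x]. *)
have L1 : 0 < `|L| + 1 by rewrite ltr_wpDl.
apply/nbhs_ballP; exists ((f s - x) / (`|L| + 1)) => /=.
  by rewrite divr_gt0// subr_gt0.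
move=> s'; rewrite ballEmdist/= ltr_pdivlMr// => ss'.
rewrite in_itv/= andbT; have := Lf s s'; rewrite ler_norml => /andP[_].
have := mdist_ge0 s s'; have := ler_norm L; nra.
Qed.

Lemma mdist_measurable (x : S) : measurable_fun [set: S] (fun s => mdist s x).
Proof.
apply: (@lipschitz_measurable 1) => s s'; rewrite mul1r.
have := metric_triangle s s' x; have := metric_triangle s' s x.
by rewrite (metric_sym s' s) ler_norml => *; apply/andP; split; lra.
Qed.

Section wasserstein.
Variables (nu1 nu2 : {measure set S -> \bar R}).
Hypotheses (nu1T : nu1 [set: S] = 1%E) (nu2T : nu2 [set: S] = 1%E).

(** The easy direction of Kantorovich duality: both sides are integrals over [g] of [v] at one
    coordinate, and these values differ by at most [L] times the distance. *)
Lemma coupling_Rintegral_le (g : probability (S * S)%type R) (v : S -> R) (L w : R) :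
  0 < L -> coupling nu1 nu2 g -> bmeas v -> lipschitz_with L v ->
  (\int[g]_p (mdist p.1 p.2)%:E <= w%:E)%E ->
  `|\int[nu1]_s v s - \int[nu2]_s v s| <= L * w.
Proof.
move=> L0 cg bv Lv gw; have gT : g [set: _] = 1%E by exact: probability_setT.
have bv1 : bmeas (fun p : S * S => v p.1) by exact: bmeas_comp.
have bv2 : bmeas (fun p : S * S => v p.2) by exact: bmeas_comp.
have fstE : \int[nu1]_s v s = \int[g]_p v p.1.
  apply: Rintegral_image => // B mB; have [<- _] := cg B mB; congr (g _).
  by apply/seteqP; split => [[x y][]|[x y]].
have sndE : \int[nu2]_s v s = \int[g]_p v p.2.
  apply: Rintegral_image => // B mB; have [_ <-] := cg B mB; congr (g _).
  by apply/seteqP; split => [[x y][]|[x y]].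
rewrite fstE sndE -bmeas_RintB//.
(* Dividing by [L] gives a bounded measurable function below the distance, so only monotonicity of
   the integral is applied to the distance itself. *)
pose u p := L^-1 * `|v p.1 - v p.2|.
have bu : bmeas u.
  apply: bmeasZ; have [mB [C BC]] := bmeasB bv1 bv2.
  by split; [exact: measurableT_comp|exists C => p; rewrite normr_id].
have uw : \int[g]_p u p <= w.
  rewrite -lee_fin bmeas_RintegralE//; apply: le_trans gw.
  apply: ge0_le_integral_nonmeasurable => p.
    by rewrite lee_fin mulr_ge0// invr_ge0 ltW.
  by rewrite lee_fin /u ler_pdivrMl.
rewrite -ler_pdivrMl//; apply: le_trans uw.
have bB := bmeasB bv1 bv2.
have -> : L^-1 * `|\int[g]_p (v p.1 - v p.2)| =
    `|\int[g]_p (L^-1 * (v p.1 - v p.2))|.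
  by rewrite bmeas_RintZ// normrM (@gtr0_norm _ L^-1)// invr_gt0.
apply: bmeas_norm_Rint => //; first exact: bmeasZ.
by move=> p; rewrite normrM (@gtr0_norm _ L^-1)// invr_gt0.
Qed.

Lemma dWas_Rintegral_le (v : S -> R) (L w : R) : 0 <= L -> bmeas v ->
  lipschitz_with L v -> (dWas nu1 nu2 <= w%:E)%E ->
  `|\int[nu1]_s v s - \int[nu2]_s v s| <= L * w.
Proof.
move=> L0 bv Lv Ww; apply/ler_addgt0Pr => e e0.
(* The infimum over couplings may not be attained, so a coupling within [e / (L + 1)] is taken; the
   added 1 keeps the divisor positive when [L = 0]. *)
have L1 : 0 < L + 1 by rewrite ltr_wpDl.
have [_ [g cg <-] gw] : exists2 y,
    [set (\int[g]_p (mdist p.1 p.2)%:E)%E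
      | g in [set g : probability (S * S)%type R | coupling nu1 nu2 g]] y &
    (y < (w + e / (L + 1))%:E)%E.
  by apply: ereal_inf_lt; rewrite (le_lt_trans Ww)// lte_fin ltrDl divr_gt0.
have [L_gt0|] := ltP 0 L.
  rewrite (le_trans (coupling_Rintegral_le L_gt0 cg bv Lv (ltW gw)))// mulrDr.
  by rewrite lerD2l mulrCA ger_pMr// ler_pdivrMr// mul1r lerDl.
(* For [L = 0] the function [v] is constant and both integrals coincide. *)
move=> L_le0; have {}L0 : L = 0 by apply/eqP; rewrite eq_le L0 L_le0.
have vc s : v s = v point.
  apply/eqP; rewrite -subr_eq0 -normr_le0 (le_trans (Lv _ _))//.
  by rewrite L0 mul0r.
under eq_Rintegral do rewrite vc.
under [X in _ - X]eq_Rintegral do rewrite vc.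
by rewrite !bmeas_Rint_cst// subrr normr0 L0 mul0r add0r ltW.
Qed.

(* An open set is the increasing limit of the Lipschitz functions
   [min 1 (n * infdist (~` U))], on which the two integrals agree. *)
Lemma dWas_le0_eq (U : set S) : (dWas nu1 nu2 <= 0)%E -> measurable U ->
  nu1 U = nu2 U.
Proof.
move=> W0 mU; apply: (measure_unique (@open S) (fun=> setT)) => //.
- exact: borel_measurableE.
- by move=> B C oB oC; exact: openI.
- by move=> _; exact: openT.
- by rewrite bigcup_const.
- move=> {mU} {}U oU; have mU := open_borel_measurable oU.
  (* If the complement of [U] is empty, [infdist] is not meaningful, but both masses are 1. *)
  have [[a0 Ua0]|U_full] := pselect (exists a0, (~` U) a0); last first.
    suff -> : U = setT by rewrite nu1T nu2T.
    apply/seteqP; split => // x _; apply: contrapT => Ux.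
    by apply: U_full; exists x.
  pose f (n : nat) (x : S) := Num.min 1 (n%:R * infdist (~` U) x).
  have D0 x : 0 <= infdist (~` U) x.
    by apply: (le_infdist Ua0) => a _; exact: mdist_ge0.
  have f0 n x : 0 <= f n x by rewrite le_min ler01 mulr_ge0.
  have f1 n x : f n x <= 1 by rewrite ge_min lexx.
  have Lf n : lipschitz_with n%:R (f n).
    move=> x y; apply: (@le_trans _ _
        (n%:R * `|infdist (~` U) x - infdist (~` U) y|)).
      rewrite -[X in X * _]normr_nat -normrM mulrBr /f.
      set p := n%:R * _; set q := n%:R * _.
      rewrite ler_norml !minEle.
      have := ler_norm (p - q); have := ler_norm (q - p).
      rewrite distrC => *.
      by apply/andP; split; case: (leP 1 p); case: (leP 1 q) => *; lra.
    by rewrite ler_wpM2l// (le_trans (infdist_lipschitz Ua0 x y))// mul1r.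
  have bf n : bmeas (f n).
    split; first exact: lipschitz_measurable (Lf n).
    by exists 1 => x; rewrite ger0_norm.
  (* Each [f n] is bounded and [n]-Lipschitz, so the duality bound is [n * 0]. *)
  have eqf n : (\int[nu1]_x (f n x)%:E = \int[nu2]_x (f n x)%:E)%E.
    rewrite -!bmeas_RintegralE//; congr _%:E; apply/eqP.
    rewrite -subr_eq0 -normr_le0 -[leRHS](mulr0 n%:R).
    exact: dWas_Rintegral_le.
  have limf x : limn (fun n => (f n x)%:E) = (\1_U x)%:E.
    apply/cvg_lim => //; apply: cvg_EFin; first exact: nearW.
    rewrite indicE; have [/set_mem Ux|/negP Ux] := boolP (x \in U).
      have [r /= r0 rU] : exists2 r, 0 < r & ball x r `<=` U.
        by have := oU; rewrite openE => /(_ x Ux)/nbhs_ballP[r r0 rU]; exists r.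
      have rD : r <= infdist (~` U) x.
        apply: (le_infdist Ua0) => a Ua; rewrite leNgt; apply/negP => xa.
        by apply: Ua; apply: rU; rewrite ballEmdist.
      apply: cvg_near_cst; near=> n.
      (* From [1 / r] on, [n] times the distance to the complement is at least 1, so the minimum
         equals 1. *)
      have rn : r^-1 <= n%:R by near: n; exact: nbhs_infty_ger.
      rewrite /f/= min_l//; apply: (@le_trans _ _ (r^-1 * r)).
        by rewrite mulVf// lt0r_neq0.
      by apply: ler_pM => //; [rewrite invr_ge0|]; exact: ltW.
    have Dx : infdist (~` U) x = 0.
      apply/eqP; rewrite eq_le D0 andbT.
      have Ax : (~` U) x by move=> /mem_set.
      by rewrite (le_trans (infdist_le x Ax))// mdistxx.
    apply: cvg_near_cst; apply: nearW => n.
    by rewrite /f/= Dx mulr0 min_r.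
  have nuU (nu : {measure set S -> \bar R}) :
      nu U = limn (fun n => \int[nu]_x (f n x)%:E)%E.
    rewrite -monotone_convergence//.
    + by under eq_integral do rewrite limf; rewrite integral_indic// setIT.
    + by move=> n; apply/measurable_EFinP; exact: (bf n).1.
    + by move=> n x _; rewrite lee_fin.
    + move=> x _ p q pq; rewrite lee_fin le_min f1/=.
      by rewrite ge_min ler_wpM2r ?ler_nat ?orbT.
  by rewrite !nuU; congr (limn _); apply/funext => n; exact: eqf.
- by move=> _; rewrite nu1T ltry.
Unshelve. all: by end_near. Qed.

End wasserstein.

End borel.

(** * Moduli of continuity *)

(** Lets [modulus_jensen] treat Lipschitz functions as well. *)
Lemma modulus_id (R : realType) : modulus (@id R).
Proof.
split => // t x y _ _; rewrite -[leLHS]/(- (t%:num * x + (1 - t%:num) * y)).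
by rewrite -[leRHS]/(t%:num * - x + (1 - t%:num) * - y); lra.
Qed.

Section modulus.
Context {R : realType} (F : R -> R) (hF : modulus F).

Lemma modulus_ge0 x : 0 <= x -> 0 <= F x.
Proof. by case: hF => + _ _; exact. Qed.

Lemma modulus_le x y : 0 <= x -> x <= y -> F x <= F y.
Proof. by case: hF => _ + _ x0 xy; apply => //; rewrite inE ?x0// (le_trans x0). Qed.

Lemma modulus_concave x y (t : R) : 0 <= x -> 0 <= y -> 0 <= t -> t <= 1 ->
  t * F x + (1 - t) * F y <= F (t * x + (1 - t) * y).
Proof.
case: hF => _ _ cF x0 y0 t0 t1.
have := cF (Itv01 t0 t1) x y; rewrite !inE => /(_ x0 y0).
rewrite -[leLHS]/(- F (t * x + (1 - t) * y)).
by rewrite -[leRHS]/(t * - F x + (1 - t) * - F y); lra.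
Qed.

(* The slope is the least difference quotient to the left of [e]. *)
Lemma modulus_supporting_line e : 0 < e ->
  exists2 m, 0 <= m & forall x, 0 <= x -> F x <= F e + m * (x - e).
Proof.
move=> e0.
pose Q := [set (F e - F y) / (e - y) | y in [set y | 0 <= y < e]].
(* Chord slopes of a concave function decrease; [e] is the convex combination of [x] and [y] with
   the weight [t] below. *)
have slope x y : 0 <= y < e -> e < x ->
    (F x - F e) / (x - e) <= (F e - F y) / (e - y).
  move=> /andP[y0 ye] ex; rewrite ler_pdivrMr ?subr_gt0//.
  rewrite mulrAC ler_pdivlMr ?subr_gt0//.
  have xy : 0 < x - y by rewrite subr_gt0 (lt_trans ye).
  pose t := (e - y) / (x - y).
  have tE : t * (x - y) = e - y by rewrite /t divfK// gt_eqF.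
  have t0 : 0 <= t by rewrite divr_ge0// ltW// subr_gt0.
  have t1 : t <= 1 by rewrite ler_pdivrMr// mul1r; lra.
  have := modulus_concave (ltW (le_lt_trans y0 (lt_trans ye ex))) y0 t0 t1.
  have -> : t * x + (1 - t) * y = e by lra.
  move=> c; have : (t * F x + (1 - t) * F y) * (x - y) <= F e * (x - y).
    by rewrite ler_pM2r.
  have -> : (t * F x + (1 - t) * F y) * (x - y) =
      t * (x - y) * F x + (x - y - t * (x - y)) * F y by ring.
  by rewrite tE; lra.
(* Monotonicity of [F] bounds the quotients below by 0, so the infimum is a nonnegative real
   slope. *)
have Q0 q : Q q -> 0 <= q.
  move=> [y /= /andP[y0 ye] <-]; rewrite divr_ge0 ?subr_ge0 ?(ltW ye)//.
  by rewrite modulus_le// ltW.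
have Qne : Q !=set0 by exists ((F e - F 0) / (e - 0)); exists 0 => //=; rewrite lexx.
have Qlb : has_lbound Q by exists 0 => q /Q0.
exists (inf Q) => [|x x0]; first exact: lb_le_inf.
rewrite -lerBlDl; have [xe|ex|->] := ltgtP x e; last by rewrite !subrr mulr0.
- have : inf Q <= (F e - F x) / (e - x) by apply: ge_inf => //; exists x => //=; rewrite x0.
  by rewrite ler_pdivlMr ?subr_gt0// => *; lra.
- rewrite -ler_pdivrMr ?subr_gt0//; apply: lb_le_inf => // _ [y /= ye <-].
  exact: slope.
Qed.

(* A concave nonnegative function vanishing at [e > 0] vanishes before [e] by
   monotonicity and after [e] by concavity. *)
Lemma modulus_eq0 e x : 0 < e -> F e = 0 -> 0 <= x -> F x = 0.
Proof.
move=> e0 Fe x0; have [xe|ex] := leP x e.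
  by apply/eqP; rewrite eq_le modulus_ge0// andbT -Fe modulus_le.
have Fx0 := modulus_ge0 x0.
have t1 : e / x <= 1 by rewrite ler_pdivrMr ?mul1r ?ltW// (lt_trans e0).
have t0 : 0 <= e / x by rewrite divr_ge0// ltW.
have := modulus_concave x0 (lexx 0) t0 t1.
rewrite mulr0 addr0 divfK ?gt_eqF ?(lt_trans e0)// Fe => c.
have F00 := modulus_ge0 (lexx 0).
have tp : 0 < e / x by rewrite divr_gt0// (lt_trans e0).
have : (1 - e / x) * F 0 >= 0 by rewrite mulr_ge0// subr_ge0.
by move=> ?; apply/eqP; rewrite eq_le Fx0 andbT -(pmulr_rle0 _ tp); lra.
Qed.

End modulus.

(** * Jensen's inequality for mean distances to a point *)

Section mean_distance.
Context {d : measure_display} {R : realType} {S : borelSpaceType d R}.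
Variables (m : {measure set S -> \bar R}) (m1 : m [set: S] = 1%E) (x : S).

(** A nonnegative distance with zero mean vanishes almost everywhere, so [m] is concentrated at
    [x]. *)
Lemma mean_mdist0_Rintegral (g : S -> R) : bmeas g ->
  (\int[m]_s (mdist s x)%:E <= 0)%E -> \int[m]_s g s = g x.
Proof.
move=> bg d0; rewrite -[RHS](bmeas_Rint_cst m1); congr fine.
have md : measurable_fun [set: S] (fun s : S => (mdist s x)%:E).
  by apply/measurable_EFinP; exact: mdist_measurable.
apply: ae_eq_integral => //; first by apply/measurable_EFinP; exact: bg.1.
have /(ae_eq_integral_abs m measurableT md) : (\int[m]_s `|(mdist s x)%:E| = 0)%E.
  apply/eqP; rewrite eq_le integral_ge0// andbT.
  by under eq_integral do rewrite gee0_abs ?lee_fin ?mdist_ge0//.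
apply: filterS => s /= + _ => /(_ Logic.I) [].
by move=> /mdist_positivity ->.
Qed.

(** The supporting line of [F] at [e] dominates [F (mdist s x)] by an affine function of the
    distance; its slope is nonnegative, so its mean is at most its value at [e]. *)
Lemma modulus_jensen (F : R -> R) (g : S -> R) (L e : R) : modulus F -> 0 <= L ->
  bmeas g -> (forall s, `|g s| <= L * F (mdist s x)) ->
  (\int[m]_s (mdist s x)%:E <= e%:E)%E ->
  `|\int[m]_s g s| <= L * F e.
Proof.
move=> hF L0 bg gF de.
have d0 : (0 <= \int[m]_s (mdist s x)%:E)%E.
  by apply: integral_ge0 => s _; rewrite lee_fin mdist_ge0.
have e0 : 0 <= e by rewrite -lee_fin (le_trans d0).
(* At 0 a concave function may have no supporting line, as for the square root; but mean distance 0
   makes the integral equal to [g x]. *)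
have [e_gt0|e_le0] := ltP 0 e; last first.
  have e00 : e = 0 by apply/eqP; rewrite eq_le e_le0.
  rewrite e00 in de *; rewrite mean_mdist0_Rintegral//.
  by rewrite (le_trans (gF x))// mdistxx.
have [a a0 Fa] := modulus_supporting_line hF e_gt0.
have id : m.-integrable [set: S] (fun s => (mdist s x)%:E).
  apply/integrableP; split; first by apply/measurable_EFinP; exact: mdist_measurable.
  under eq_integral do rewrite gee0_abs ?lee_fin ?mdist_ge0//.
  by rewrite (le_lt_trans de)// ltry.
have iL : m.-integrable [set: S] (fun s => (L * a * mdist s x)%:E).
  by under eq_fun do rewrite EFinM; exact: integrableZl.
have ic : m.-integrable [set: S] (fun s => (L * (F e - a * e))%:E).
  exact/bmeas_integrable/bmeas_cst.
have ba : bmeas (fun s => `|g s|).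
  have [mg [C gC]] := bg; split; first exact: measurableT_comp.
  by exists C => s; rewrite normr_id.
apply: (@le_trans _ _ (\int[m]_s `|g s|)); first exact: bmeas_norm_Rint.
apply: (@le_trans _ _ (\int[m]_s (L * (F e - a * e) + L * a * mdist s x))).
  apply: le_Rintegral => //.
  - exact: bmeas_integrable.
  - exact: (integrableD measurableT ic iL).
  - move=> s _; rewrite (le_trans (gF s))//.
    by have := ler_wpM2l L0 (Fa (mdist s x) (mdist_ge0 _ _)); lra.
rewrite RintegralD// (bmeas_Rint_cst m1).
rewrite RintegralZl//.
have : \int[m]_s mdist s x <= e by rewrite -lee_fin fineK// integrable_fin_num.
by move=> /(ler_wpM2l (mulr_ge0 L0 a0)); lra.
Qed.

End mean_distance.

(** * Value functions *)

Section real_values.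
Context {dS dY dA : measure_display} {R : realType} {S : borelSpaceType dS R}
  {Y : borelSpaceType dY R} {A : borelSpaceType dA R} (P : pomdp S Y A).
Local Notation T := (horizon P).
Local Notation M := (pomdp_mdp P).

Lemma bmeas_cost t : (t < T)%N -> bmeas (cost P t).
Proof.
by move=> tT; split; [exact: measurable_cost|exists (cmax P); exact: cost_bounded].
Qed.

Definition state_kernel (t : nat) : R.-pker (S * A) ~> S := mfst_kernel (trans P t).

Lemma state_kernelE t sa (f : S -> R) : bmeas f ->
  \int[state_kernel t sa]_s f s = \int[trans P t sa]_z f z.1.
Proof.
by move=> bf; apply: Rintegral_image => //; exact: prob_kernel.
Qed.

(** The second alternative covers the last decision time, where [mdp_Q] drops the integral and the
    next value is 0. *)
Lemma mdp_QE t (v : S -> R) s a : bmeas v -> ((t.+1 < T)%N \/ v = fun=> 0) ->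
  mdp_Q M t (EFin \o v) s a =
  (cost P t (s, a) + \int[state_kernel t (s, a)]_s' v s')%:E.
Proof.
move=> bv; rewrite /mdp_Q EFinD; case: ifPn => [tT _|_ [//|->]].
  by rewrite bmeas_RintegralE ?prob_kernel.
by rewrite bmeas_Rint_cst ?prob_kernel.
Qed.

Hypothesis hsel : measurable_selection M.

(** Backward induction: measurable selection makes the infimum a finite measurable function, and
    each stage raises the bound by at most [cmax P]. *)
Let real_value_to_go n : forall t, (n + t = T)%N ->
  exists2 v : S -> R, bmeas v & mdp_value_to_go M n t = EFin \o v.
Proof.
elim: n => [t _|n IH t ntT]; first by exists (fun=> 0) => //; exact: bmeas_cst.
have [v bv vE] : exists2 v : S -> R, bmeas v & mdp_value_to_go M n t.+1 = EFin \o v.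
  by apply: IH; rewrite addnS.
have tT : (t < T)%N by rewrite -ntT addSn ltnS leq_addl.
have v0 : (t.+1 < T)%N \/ v = fun=> 0.
  have [n0|n0] := eqVneq n 0%N; last by left; lia.
  rewrite n0 in vE; right; apply/funext => s; apply: EFin_inj.
  by rewrite -[LHS]/((EFin \o v) s) -vE.
have [|pi [V [_ mV VE]]] := hsel tT bv.1.
  by move=> _ sa; apply: bmeas_integrable => //; exact: prob_kernel.
exists V; last by apply/funext => s /=; rewrite vE; have [-> _] := VE s.
split => //; have [C vC] := bv.2; exists (cmax P + C) => s.
have [_] := VE s; rewrite mdp_QE// => -[<-].
rewrite (le_trans (ler_normD _ _))// lerD//; first exact: cost_bounded.
by apply: bmeas_norm_Rint_le => //; exact: prob_kernel.
Qed.

Definition real_value (t : nat) (s : S) : R := fine (mdp_value M t s).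

Lemma real_value_spec t : (t <= T)%N ->
  bmeas (real_value t) /\ mdp_value M t = EFin \o real_value t.
Proof.
move=> tT; have [v bv vE] := real_value_to_go (subnK tT).
have -> : real_value t = v.
  by apply/funext => s; rewrite /real_value /mdp_value vE.
by split.
Qed.

Definition real_Q t s a :=
  cost P t (s, a) + \int[state_kernel t (s, a)]_s' real_value t.+1 s'.

Lemma real_value_horizon : real_value T = fun=> 0.
Proof. by apply/funext => s; rewrite /real_value /mdp_value subnn. Qed.

Let mdp_Q_real_Q t s a : (t < T)%N ->
  mdp_Q M t (mdp_value M t.+1) s a = (real_Q t s a)%:E.
Proof.
move=> tT; have [bv ->] := real_value_spec tT.
apply: mdp_QE => //; move: tT; rewrite leq_eqVlt => /orP[/eqP ->|]; last by left.
by right; exact: real_value_horizon.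
Qed.

(** Together with [optimal_Q], supplies the sign condition of the final induction: an inequality for
    arbitrary policies, an equality for the certainty equivalent one. *)
Lemma real_value_le_Q t s a : (t < T)%N -> real_value t s <= real_Q t s a.
Proof.
move=> tT; rewrite -lee_fin -mdp_Q_real_Q//.
have [_ /(congr1 (@^~ s))/= <-] := real_value_spec (ltnW tT).
rewrite /mdp_value -(subnSK tT)/=.
by apply: ereal_inf_lbound; exists a.
Qed.

Lemma optimal_Q pi t s : mdp_optimal_policy M pi -> (t < T)%N ->
  real_Q t s (pi t s) = real_value t s.
Proof.
move=> hpi tT; have [_ /(_ s)] := hpi t tT; rewrite mdp_Q_real_Q//.
by have [_ ->] := real_value_spec (ltnW tT) => -[].
Qed.

End real_values.

(** * Policy evaluation as a backward recursion *)

Section cost_to_go.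
Context {dS dY dA : measure_display} {R : realType} {S : borelSpaceType dS R}
  {Y : borelSpaceType dY R} {A : borelSpaceType dA R} (P : pomdp S Y A).
Local Notation T := (horizon P).
Variable mu : policy Y A.

(* Given the true state as well as the history, the expected cost of n stages
   obeys a recursion that does not involve the beliefs. *)
Fixpoint cost_to_go (n t : nat) : S * hist Y A t -> R :=
  if n is n'.+1 then fun w =>
    cost P t (w.1, mu w.2) + \int[trans P t (w.1, mu w.2)]_z
      cost_to_go n' (z.1, ((w.2, mu w.2), z.2) : hist Y A t.+1)
  else fun=> 0.

Hypothesis hmu : measurable_policy P mu.

Lemma bmeas_cost_to_go n t : (n + t = T)%N -> bmeas (@cost_to_go n t).
Proof.
elim: n t => [t _|n IH t ntT]; first exact: bmeas_cst.
have tT : (t < T)%N by rewrite -ntT addSn ltnS leq_addl.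
have mmu : measurable_fun [set: S * hist Y A t] (fun w => mu w.2).
  by apply: measurableT_comp => //; exact: hmu.
have mwa : measurable_fun [set: S * hist Y A t] (fun w => (w.1, mu w.2)).
  exact: measurable_fun_pair.
apply: bmeasD; first by apply: bmeas_comp mwa; exact: bmeas_cost.
pose step (q : (S * hist Y A t) * (S * Y)) : S * hist Y A t.+1 :=
  (q.2.1, ((q.1.2, mu q.1.2), q.2.2)).
have mstep : measurable_fun setT step.
  apply: measurable_fun_pair; first exact: (measurableT_comp measurable_fst).
  apply: measurable_fun_pair; last exact: (measurableT_comp measurable_snd).
  apply: measurable_fun_pair; first exact: (measurableT_comp measurable_snd).
  exact: (measurableT_comp mmu).
have bstep : bmeas (fun q => cost_to_go n (step q)).
  by apply: bmeas_comp mstep; apply: IH; rewrite addnS.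
exact: (bmeas_kernel (kpull (trans P t) mwa) bstep).
Qed.

Variables (b : forall t, R.-pker (hist Y A t) ~> S).

Definition mean_cost_to_go (t : nat) (h : hist Y A t) : R :=
  \int[b t h]_s cost_to_go (T - t) (s, h).

Lemma bmeas_cost_to_go_hist n t (h : hist Y A t) : (n + t = T)%N ->
  bmeas (fun s => cost_to_go n (s, h)).
Proof. by move=> ntT; apply: bmeas_comp => //; exact: bmeas_cost_to_go. Qed.

(** Advances a run by one transition. Here [c] stands for a run cost that already includes the
    current stage, which [cost_to_go n.+1 w] counts again; hence the subtraction. *)
Lemma cost_to_go_step n t (w : S * hist Y A t) c : (n.+1 + t = T)%N ->
  (\int[trans P t (w.1, mu w.2)]_z
    (c + cost_to_go n (z.1, ((w.2, mu w.2), z.2) : hist Y A t.+1))%:E)%E =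
  (c - cost P t (w.1, mu w.2) + cost_to_go n.+1 w)%:E.
Proof.
move=> ntT; have bJ : bmeas (fun z : S * Y =>
    cost_to_go n (z.1, ((w.2, mu w.2), z.2) : hist Y A t.+1)).
  apply: bmeas_comp; first by apply: bmeas_cost_to_go; rewrite addnS.
  by apply: measurable_fun_pair => //; apply: measurable_fun_pair.
rewrite -bmeas_RintegralE ?prob_kernel//; last first.
  by apply: bmeasD => //; exact: bmeas_cst.
rewrite bmeas_RintD ?prob_kernel//; last exact: bmeas_cst.
by rewrite bmeas_Rint_cst ?prob_kernel//=; congr EFin; ring.
Qed.

(** Links the forward evaluation along runs to the backward recursion averaged over the current
    belief. *)
Lemma policy_valueE t (h : hist Y A t) : (t < T)%N ->
  policy_value P b mu h = (mean_cost_to_go h)%:E.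
Proof.
move=> tT.
(* Completing the cost of the first stages by the cost-to-go makes the
   expectation independent of [k]. *)
pose f k (w : run k) := (run_cost P mu h w
  - cost P (k + t) (run_state w, run_action mu h w)
  + cost_to_go (T - (k + t)) (run_state w, run_hist mu h w))%:E.
have runE k : (k + t < T)%N ->
    run_expectation P b mu h (f k) = (mean_cost_to_go h)%:E.
  elim: k => [_|k IH ktT].
    rewrite /mean_cost_to_go bmeas_RintegralE ?prob_kernel//; last first.
      by apply: bmeas_cost_to_go_hist; rewrite subnK// ltnW.
    by apply: eq_integral => s _; rewrite /f/= subrr add0r.
  rewrite -IH; last by lia.
  apply: (congr1 (run_expectation P b mu h (k := k))).
  apply/funext => w; rewrite /f.
  have nE : ((T - (k.+1 + t)).+1 + (k + t) = T)%N by lia.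
  have := cost_to_go_step (run_state w, run_hist mu h w) (run_cost P mu h w) nE.
  have -> : (T - (k.+1 + t)).+1 = (T - (k + t))%N by lia.
  rewrite -[(_, _).1]/(run_state w) -[(_, _).2]/(run_hist mu h w) => <-.
  by apply: eq_integral => z _ /=; rewrite addrK.
rewrite -(runE (T.-1 - t)%N); last lia.
apply: (congr1 (run_expectation P b mu h (k := _))).
apply/funext => w; rewrite /f.
(* At the end of the run one stage remains, and its cost cancels the correction in [f]. *)
have -> : (T - (T.-1 - t + t) = 1)%N by lia.
by rewrite /= bmeas_Rint_cst ?prob_kernel// addr0 subrK.
Qed.

End cost_to_go.

(** * The value gap *)

Section lipschitz_constant.
Context {d : measure_display} {R : realType} {S : borelSpaceType d R}.

Lemma Lip_ge0 (f : S -> \bar R) : (0 <= Lip f)%E.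
Proof. by apply: le_ereal_inf_tmp => _ [L [L0 _] <-]; rewrite lee_fin. Qed.

(** The infimum is attained: at positive distance every admissible constant is at least the
    difference quotient, hence so is their infimum. *)
Lemma Lip_lipschitz (v : S -> R) : (Lip (EFin \o v) < +oo)%E ->
  lipschitz_with (fine (Lip (EFin \o v))) v.
Proof.
move=> Loo s s'; have L_fin : Lip (EFin \o v) \is a fin_num.
  by rewrite ge0_fin_numE// Lip_ge0.
have [ss'|ss'] := leP (mdist s s') 0.
  have /mdist_positivity -> : mdist s s' = 0.
    by apply/eqP; rewrite eq_le ss' mdist_ge0.
  by rewrite subrr normr0 mdistxx mulr0.
rewrite -ler_pdivrMr// -lee_fin fineK//.
apply: le_ereal_inf_tmp => _ [L [_ vL] <-]; rewrite lee_fin ler_pdivrMr//.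
by rewrite -lee_fin; exact: vL.
Qed.

End lipschitz_constant.

(** * One-step errors and the backward induction over time *)

Section certainty_equivalence.
Context (dS dY dA : measure_display) (R : realType)
    (S : borelSpaceType dS R) (Y : borelSpaceType dY R)
    (A : borelSpaceType dA R) (P : pomdp S Y A)
    (b : forall t, R.-pker (hist Y A t) ~> S) (hb : is_belief P b)
    (E : forall t, hist Y A t -> S)
    (hsel : measurable_selection (pomdp_mdp P))
    (FP Fc : nat -> R -> R)
    (hFP : forall t, (t.+1 < horizon P)%N -> modulus (FP t))
    (hFc : forall t, (t < horizon P)%N -> modulus (Fc t))
    (hP : forall t, (t.+1 < horizon P)%N -> forall (s s' : S) (a : A),
      (dWas (mdp_trans (pomdp_mdp P) t (s, a))
           (mdp_trans (pomdp_mdp P) t (s', a)) <= (FP t (mdist s s'))%:E)%E)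
    (hc : forall t, (t < horizon P)%N -> forall (s s' : S) (a : A),
      (`|cost P t (s, a) - cost P t (s', a)| <= Fc t (mdist s s'))%R)
    (heta : forall t, (t < horizon P)%N -> (estimation_error b E t < +oo)%E).
Local Notation T := (horizon P).
Local Notation v := (real_value P).

Let eta t := fine (estimation_error b E t).
Let next_value t a s := \int[state_kernel P t (s, a)]_s' v t.+1 s'.

Lemma mean_mdist_le t (h : hist Y A t) : (t < T)%N ->
  (\int[b t h]_s (mdist s (E h))%:E <= (eta t)%:E)%E.
Proof.
move=> tT.
have le_err : (\int[b t h]_s (mdist s (E h))%:E <= estimation_error b E t)%E.
  by apply: ereal_sup_ubound; exists h.
have int0 : (0 <= \int[b t h]_s (mdist s (E h))%:E)%E.
  by apply: integral_ge0 => s _; rewrite lee_fin mdist_ge0.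
by rewrite fineK// ge0_fin_numE ?heta// (le_trans int0).
Qed.

Lemma estimation_error_ge0 t (h : hist Y A t) : (t < T)%N -> 0 <= eta t.
Proof.
move=> tT; rewrite -lee_fin (le_trans _ (mean_mdist_le h tT))//.
by apply: integral_ge0 => s _; rewrite lee_fin mdist_ge0.
Qed.

Lemma bmeas_next_value t a : (t < T)%N -> bmeas (next_value t a).
Proof.
move=> tT; have [bv _] := real_value_spec hsel tT.
have bv2 : bmeas (fun p : S * S => v t.+1 p.2) by exact: bmeas_comp.
exact: (bmeas_kernel (kpull (state_kernel P t) (pair2_measurable a)) bv2).
Qed.

Lemma mean_shift t (h : hist Y A t) (f : S -> R) : bmeas f ->
  \int[b t h]_s f s - f (E h) = \int[b t h]_s (f s - f (E h)).
Proof.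
move=> bf; rewrite bmeas_RintB ?prob_kernel//; last exact: bmeas_cst.
by rewrite bmeas_Rint_cst ?prob_kernel.
Qed.

(* [0 * +oo = 0] makes the case of a vanishing coefficient genuine: [v] need not
   be Lipschitz there, but then the estimates and the kernels are exact. *)
Definition transition_gap t (k : \bar R) :=
  k = +oo%E \/ exists k1 k2, [/\ k = (k1 + k2)%:E,
    forall h : hist Y A t.+1, `|\int[b t.+1 h]_s v t.+1 s - v t.+1 (E h)| <= k1 &
    forall (h : hist Y A t) a,
      `|\int[b t h]_s next_value t a s - next_value t a (E h)| <= k2].

(** Three cases: a finite Lipschitz constant, where duality and Jensen apply; an infinite one with
    positive coefficient, giving [+oo]; an infinite one with coefficient 0. *)
Lemma transition_gapP t : (t.+1 < T)%N ->
  transition_gap t ((FP t (eta t) + eta t.+1)%:E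
    * Lip (mdp_value (pomdp_mdp P) t.+1))%E.
Proof.
move=> tT; have tT' := ltnW tT.
have [bv ->] := real_value_spec hsel tT'.
have eta1 := estimation_error_ge0 point tT.
have eta0 := estimation_error_ge0 point tT'.
have FP0 := modulus_ge0 (hFP tT) eta0.
have [LT|] := ltP (Lip (EFin \o v t.+1)) +oo%E.
  right; set L := fine (Lip (EFin \o v t.+1)).
  have L0 : 0 <= L by rewrite fine_ge0// Lip_ge0.
  have vL : lipschitz_with L (v t.+1) := Lip_lipschitz LT.
  exists (L * eta t.+1), (L * FP t (eta t)); split.
  - rewrite -[Lip _]fineK; last by rewrite ge0_fin_numE// Lip_ge0.
    by rewrite -EFinM -/L; congr EFin; ring.
  - move=> h; rewrite mean_shift//.
    apply: (@modulus_jensen _ _ _ (b t.+1 h) _ (E h) id) => //.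
    + exact: prob_kernel.
    + exact: modulus_id.
    + by apply: bmeasB => //; exact: bmeas_cst.
    + exact: mean_mdist_le.
  - move=> h a; have br := bmeas_next_value a tT'.
    rewrite mean_shift//.
    apply: (@modulus_jensen _ _ _ (b t h) _ (E h)) => //.
    + exact: prob_kernel.
    + exact: hFP.
    + by apply: bmeasB => //; exact: bmeas_cst.
    (* Duality turns the Wasserstein bound [hP] into a modulus of continuity for [next_value]. *)
    + by move=> s; apply: dWas_Rintegral_le; rewrite ?prob_kernel//; exact: hP.
    + exact: mean_mdist_le.
rewrite leye_eq => /eqP LT; rewrite LT.
have [del0|del0] := ltP 0 (FP t (eta t) + eta t.+1).
  by left; rewrite gt0_muley// lte_fin.
(* Two nonnegative summands whose sum is at most 0 both vanish. *)
have eta10 : eta t.+1 = 0 by lra.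
have FPeta : FP t (eta t) = 0 by lra.
right; exists 0, 0; split.
- by rewrite FPeta eta10 !addr0 mul0e.
- move=> h; rewrite (@mean_mdist0_Rintegral _ _ _ _ _ (E h)) ?prob_kernel//
      ?subrr ?normr0//.
  by rewrite (le_trans (mean_mdist_le h tT))// lee_fin eta10.
- move=> h a; have br := bmeas_next_value a tT'.
  (* If [eta t] is 0, the belief is concentrated at the estimate. Otherwise [FP t] vanishes on all
     nonnegative reals, so the state kernels, and with them [next_value], do not depend on the
     state. *)
  have [e0|e0] := ltP 0 (eta t); last first.
    rewrite (@mean_mdist0_Rintegral _ _ _ _ _ (E h)) ?prob_kernel//
      ?subrr ?normr0//.
    by rewrite (le_trans (mean_mdist_le h tT'))// lee_fin.
  have nc s : next_value t a s = next_value t a (E h).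
    congr fine; apply: eq_measure_integral => U mU _.
    apply: dWas_le0_eq; rewrite ?prob_kernel//.
    by rewrite (le_trans (hP tT _ _ _))// (modulus_eq0 (hFP tT) e0 FPeta)// mdist_ge0.
  under eq_Rintegral do rewrite nc.
  by rewrite bmeas_Rint_cst ?prob_kernel// subrr normr0.
Qed.

Lemma mean_cost_gap t (h : hist Y A t) a : (t < T)%N ->
  `|\int[b t h]_s cost P t (s, a) - cost P t (E h, a)| <= Fc t (eta t).
Proof.
move=> tT; have bca : bmeas (fun s => cost P t (s, a)).
  by apply: (bmeas_comp (bmeas_cost tT)); exact: pair2_measurable.
rewrite (mean_shift h bca) -[leRHS]mul1r.
apply: (@modulus_jensen _ _ _ (b t h) _ (E h)) => //.
- exact: prob_kernel.
- exact: hFc.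
- by apply: bmeasB => //; exact: bmeas_cst.
- by move=> s; rewrite mul1r; exact: hc.
- exact: mean_mdist_le.
Qed.

(* The sign [sg] lets one induction prove both the upper bound for the
   certainty equivalent policy and the lower bound for an arbitrary one. *)
Section policy_gap.
Variables (sg : R) (sg1 : `|sg| = 1) (mu : policy Y A).
Hypothesis hmu : measurable_policy P mu.
Local Notation W := (mean_cost_to_go P mu b).

Lemma sign_mul_le x c : `|x| <= c -> sg * x <= c.
Proof. by apply: le_trans; rewrite -[leRHS]mul1r -sg1 -normrM ler_norm. Qed.

(** The difference splits into a cost error, a next-value error and the mean excess of the future
    cost over the optimal value. The bounds [k] and [K] stay abstract so that the last stage can
    take both to be 0. *)
Lemma bellman_gap t (h : hist Y A t) k K : (t < T)%N ->
  `|\int[b t h]_s next_value t (mu h) s - next_value t (mu h) (E h)| <= k ->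
  sg * (\int[b t h]_s (\int[trans P t (s, mu h)]_z
    (cost_to_go P mu (T - t.+1) (z.1, ((h, mu h), z.2) : hist Y A t.+1)
     - v t.+1 z.1))) <= K ->
  sg * (W h - real_Q P t (E h) (mu h)) <= Fc t (eta t) + k + K.
Proof.
move=> tT kP KP; set a := mu h.
have [bv _] := real_value_spec hsel tT.
have ntT : (T - t.+1 + t.+1 = T)%N by rewrite subnK.
have bJ : bmeas (fun z : S * Y =>
    cost_to_go P mu (T - t.+1) (z.1, ((h, a), z.2) : hist Y A t.+1)).
  apply: bmeas_comp; first exact: bmeas_cost_to_go.
  by apply: measurable_fun_pair => //; apply: measurable_fun_pair.
have bv1 : bmeas (fun z : S * Y => v t.+1 z.1) by exact: bmeas_comp.
have bJv := bmeasB bJ bv1.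
have bI (f : S * Y -> R) : bmeas f -> bmeas (fun s => \int[trans P t (s, a)]_z f z).
  move=> bf; have bf2 : bmeas (fun p : S * (S * Y) => f p.2) by exact: bmeas_comp.
  exact: (bmeas_kernel (kpull (trans P t) (pair2_measurable a)) bf2).
have bca : bmeas (fun s => cost P t (s, a)).
  by apply: (bmeas_comp (bmeas_cost tT)); exact: pair2_measurable.
have WE : W h = \int[b t h]_s cost P t (s, a) + \int[b t h]_s next_value t a s
    + \int[b t h]_s (\int[trans P t (s, a)]_z
       (cost_to_go P mu (T - t.+1) (z.1, ((h, a), z.2) : hist Y A t.+1)
        - v t.+1 z.1)).
  rewrite -bmeas_RintD ?prob_kernel//; last exact: bmeas_next_value.
  rewrite -bmeas_RintD ?prob_kernel//; last 2 first.
  - by apply: bmeasD => //; exact: bmeas_next_value.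
  - exact: bI.
  rewrite /mean_cost_to_go -(subnSK tT)/=; apply: eq_Rintegral => s _.
  rewrite bmeas_RintB ?prob_kernel// /next_value state_kernelE// -/a.
  by rewrite /=; ring.
rewrite WE.
have c1 := sign_mul_le (mean_cost_gap h a tT).
have c2 := sign_mul_le kP.
move: KP c1 c2; rewrite -/a /real_Q -/(next_value t a (E h)).
set x := \int[_]_ _ _; set y := \int[_]_ _ _; set z := \int[_]_ _ _.
by move=> *; lra.
Qed.

Hypothesis mu_gap : forall t (h : hist Y A t), (t < T)%N ->
  sg * (real_Q P t (E h) (mu h) - v t (E h)) <= 0.

(** After disintegration the inner integral is [W h'] minus the belief average of the next value;
    inserting the value at [E h'] leaves an induction term and an estimation error. *)
Lemma future_gap t (h : hist Y A t) k r : (t.+1 < T)%N ->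
  (forall h' : hist Y A t.+1,
    `|\int[b t.+1 h']_s v t.+1 s - v t.+1 (E h')| <= k) ->
  (forall h' : hist Y A t.+1, sg * (W h' - v t.+1 (E h')) <= r) ->
  sg * (\int[b t h]_s (\int[trans P t (s, mu h)]_z
    (cost_to_go P mu (T - t.+1) (z.1, ((h, mu h), z.2) : hist Y A t.+1)
     - v t.+1 z.1))) <= k + r.
Proof.
move=> tT vk Wr; set a := mu h.
have [bv _] := real_value_spec hsel (ltnW tT).
have ntT : (T - t.+1 + t.+1 = T)%N by rewrite subnK// ltnW.
pose f (z : S * Y) :=
  cost_to_go P mu (T - t.+1) (z.1, ((h, a), z.2) : hist Y A t.+1) - v t.+1 z.1.
have bf : bmeas f.
  apply: bmeasB; last exact: bmeas_comp.
  apply: bmeas_comp; first exact: bmeas_cost_to_go.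
  by apply: measurable_fun_pair => //; apply: measurable_fun_pair.
rewrite (prediction_disintegration hb tT h a bf).
have mhist : measurable_fun [set: S * Y] (fun z => ((h, a), z.2) : hist Y A t.+1).
  exact: measurable_fun_pair.
have bfs : bmeas (fun p : (S * Y) * S => f (p.2, p.1.2)).
  apply: (bmeas_comp bf); apply: measurable_fun_pair => //.
  exact: (measurableT_comp measurable_snd).
have bg := bmeas_kernel (kpull (b t.+1) mhist) bfs.
rewrite -bmeas_RintZ ?prob_kernel//.
apply: bmeas_Rint_le; [exact: prob_kernel|exact: bmeasZ|move=> z].
set h' : hist Y A t.+1 := ((h, a), z.2).
have -> : \int[kpull (b t.+1) mhist z]_s f (s, z.2) =
    W h' - \int[b t.+1 h']_s v t.+1 s.
  by rewrite -bmeas_RintB ?prob_kernel//; exact: bmeas_cost_to_go_hist.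
have := vk h'; rewrite distrC => /sign_mul_le; have := Wr h'.
by lra.
Qed.

Let alpha t : \bar R := ((Fc t (eta t))%:E + \sum_(t <= u < T.-1)
  ((FP u (eta u) + eta u.+1)%:E * Lip (mdp_value (pomdp_mdp P) u.+1)
   + (Fc u.+1 (eta u.+1))%:E))%E.

(** Backward induction on the number [n] of stages after [t]. Nonnegativity of [alpha] is carried
    along to exclude [-oo], so that one infinite term makes the whole sum [+oo]. *)
Lemma value_gap n t : (n + t.+1 = T)%N -> (0 <= alpha t)%E /\
  forall h : hist Y A t, ((sg * (W h - v t (E h)))%:E <= alpha t)%E.
Proof.
elim: n t => [|n IH] t ntT.
  have tT : (t < T)%N by lia.
  have -> : alpha t = (Fc t (eta t))%:E by rewrite /alpha big_geq ?adde0//; lia.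
  split=> [|h].
    by rewrite lee_fin modulus_ge0//; [exact: hFc|exact: (estimation_error_ge0 point)].
  (* At the last time the next value is 0, so the transition and future errors vanish. *)
  have vT : v t.+1 = fun=> 0.
    by have -> : t.+1 = T by []; exact: real_value_horizon.
  have nv a s : next_value t a s = 0.
    by rewrite /next_value vT bmeas_Rint_cst ?prob_kernel.
  rewrite lee_fin; have q0 := mu_gap h tT.
  suff : sg * (W h - real_Q P t (E h) (mu h)) <= Fc t (eta t) + 0 + 0 by lra.
  apply: bellman_gap => //.
  - under eq_Rintegral do rewrite nv.
    by rewrite bmeas_Rint_cst ?prob_kernel// nv subrr normr0.
  - under eq_Rintegral.
      move=> s _; have -> : (T - t.+1 = 0)%N by lia.
      rewrite vT/=; under eq_Rintegral do rewrite subrr.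
      rewrite bmeas_Rint_cst ?prob_kernel//; over.
    by rewrite bmeas_Rint_cst ?prob_kernel// mulr0.
have tT : (t.+1 < T)%N by lia.
have tT' := ltnW tT.
have [alpha0 IHh] := IH t.+1 ltac:(lia).
have eps0 : 0 <= Fc t (eta t).
  by rewrite modulus_ge0//; [exact: hFc|exact: (estimation_error_ge0 point)].
(* The cost error in the first summand becomes the leading term of [alpha t.+1]. *)
have -> : alpha t = ((Fc t (eta t))%:E +
    ((FP t (eta t) + eta t.+1)%:E * Lip (mdp_value (pomdp_mdp P) t.+1)
     + alpha t.+1))%E.
  rewrite /alpha [in LHS]big_ltn; last by lia.
  by rewrite !addeA.
have [->|[k1 [k2 [-> hk1 hk2]]]] := transition_gapP tT.
  rewrite addye; last by rewrite gt_eqF// (lt_le_trans _ alpha0)// ltNyr.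
  by rewrite addey//; split => // h; rewrite leey.
case: (alpha t.+1) alpha0 IHh => [r| |] // r0 IHh; last first.
  by rewrite !addey//; split => // h; rewrite leey.
rewrite -!EFinD; have k10 := le_trans (normr_ge0 _) (hk1 point).
have k20 := le_trans (normr_ge0 _) (hk2 point point).
rewrite lee_fin in r0; split => [|h]; first by rewrite lee_fin; lra.
have Wr (h' : hist Y A t.+1) : sg * (W h' - v t.+1 (E h')) <= r.
  by rewrite -lee_fin.
have := bellman_gap tT' (hk2 h (mu h)) (future_gap h tT hk1 Wr).
by have := mu_gap h tT'; rewrite lee_fin; lra.
Qed.

End policy_gap.

End certainty_equivalence.

Local Open Scope ereal_scope.

Theorem theorem1 (dS dY dA : measure_display) (R : realType)
    (S : borelSpaceType dS R) (Y : borelSpaceType dY R)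
    (A : borelSpaceType dA R) (P : pomdp S Y A)
    (b : forall t, R.-pker (hist Y A t) ~> S) (hb : is_belief P b)
    (E : forall t, hist Y A t -> S)
    (hE : forall t, (t < horizon P)%N ->
      measurable_fun [set: hist Y A t] (E t))
    (hsel : measurable_selection (pomdp_mdp P))
    (FP Fc : nat -> R -> R)
    (hFP : forall t, (t.+1 < horizon P)%N -> modulus (FP t))
    (hFc : forall t, (t < horizon P)%N -> modulus (Fc t))
    (hP : forall t, (t.+1 < horizon P)%N -> forall (s s' : S) (a : A),
      dWas (mdp_trans (pomdp_mdp P) t (s, a))
           (mdp_trans (pomdp_mdp P) t (s', a)) <= (FP t (mdist s s'))%:E)
    (hc : forall t, (t < horizon P)%N -> forall (s s' : S) (a : A),
      (`|cost P t (s, a) - cost P t (s', a)| <= Fc t (mdist s s'))%R)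
    (heta : forall t, (t < horizon P)%N -> estimation_error b E t < +oo)
    (pi : nat -> S -> A) (hpi : mdp_optimal_policy (pomdp_mdp P) pi) :
  let V := mdp_value (pomdp_mdp P) in
  let muE := fun t (h : hist Y A t) => pi t (E t h) in
  let eta := fun t => fine (estimation_error b E t) in
  let eps := fun t => Fc t (eta t) in
  let delta := fun t => (FP t (eta t) + eta t.+1)%R in
  let alpha := fun t => (eps t)%:E +
    \sum_(t <= u < (horizon P).-1)
      ((delta u)%:E * Lip (V u.+1) + (eps u.+1)%:E) in
  forall t, (t < horizon P)%N -> forall h : hist Y A t,
    policy_value P b muE h - pomdp_value P b h <= 2%:E * alpha t.
Proof.
move=> V muE eta eps delta alpha t tT h.
have hmuE : measurable_policy P muE.
  by move=> u uT; exact: (measurableT_comp (hpi u uT).1 (hE u uT)).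
have ntT : (horizon P - t.+1 + t.+1 = horizon P)%N by rewrite subnK.
have [] := value_gap hb hsel hFP hFc hP hc heta (normr1 R) hmuE _ ntT.
  (* With sign 1, optimality of [pi] at the estimate makes the Bellman gap exactly 0. *)
  move=> u h' uT; rewrite /muE optimal_Q//.
  by rewrite subrr mulr0.
rewrite -[(_ + _)%E]/(alpha t) => alpha0 /(_ h) upper.
(* With sign -1 the bound holds for every competing policy, and so passes to the infimum in
   [pomdp_value]. *)
have lower mu : measurable_policy P mu ->
    (-1 * (mean_cost_to_go P mu b h - real_value P t (E t h)))%:E <= alpha t.
  move=> hmu; have sgN1 : `|-1 : R|%R = 1%R by rewrite normrN1.
  have [|_] := value_gap hb hsel hFP hFc hP hc heta sgN1 hmu _ ntT; last exact.
  move=> u h' uT; rewrite mulN1r oppr_le0 subr_ge0.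
  exact: real_value_le_Q.
rewrite (policy_valueE hmuE b h tT).
(* Nonnegativity rules out [-oo], and for [+oo] the claim is trivial. *)
move: alpha0 upper lower; case: (alpha t) => [r| |]//= _ upper lower; last first.
  by rewrite gt0_muley ?leey// lte_fin.
have inf_ge : (real_value P t (E t h) - r)%:E <= pomdp_value P b h.
  apply: le_ereal_inf_tmp => _ [mu hmu <-]; rewrite (policy_valueE hmu b h tT).
  by have := lower mu hmu; rewrite !lee_fin; lra.
rewrite (le_trans (leeB (lexx _) inf_ge))// -EFinB -EFinM lee_fin.
by move: upper; rewrite lee_fin mul1r; lra.
Qed.
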